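(* Let $(\gamma,\widetilde\gamma)$ be a non-helical and non-planar Bertrand pair in Euclidean 3-space, parameterized by the arclengths $s$ and $s^{*}$ respectively ($\gamma$ the Bertrand curve, $\widetilde\gamma$ its mate). Then the Bertrand curve $\gamma$ is a slant helix if and only if the binormal indicatrix $\widetilde\gamma_b=\widetilde B$ of the Bertrand mate curve $\widetilde\gamma$ is a spherical helix.
   Context: Curves are smooth regular curves in $\mathbb{R}^3$ with non-vanishing curvature; $\gamma$ has Frenet frame $T,N,B$, curvature $\kappa$, torsion $\tau$, and $\widetilde\gamma$ has $\widetilde T,\widetilde N,\widetilde B,\widetilde\kappa,\widetilde\tau$. The pair $(\gamma,\widetilde\gamma)$ is a Bertrand pair if there is a correspondence of points such that the principal normals at corresponding points are linearly dependent, $N=\epsilon\widetilde N$ with $\epsilon=\pm1$, and $\widetilde\gamma(s^{*})=\gamma(s)+\lambda N(s)$ with $\lambda\neq0$ constant. Non-helical means that torsion/curvature of each curve is not constant, non-planar that the torsions are non-zero; the quotients $\tau/\kappa$, $\tau'/\kappa'$, $\widetilde\tau/\widetilde\kappa$, $\widetilde\tau'/\widetilde\kappa'$ are assumed to be defined (denominators non-zero, and the two quotients of each curve different and non-zero at each point). A slant helix is a curve whose principal normal lines make a constant angle with a fixed straight line. The binormal indicatrix of $\widetilde\gamma$ is the curve $s^{*}\mapsto\widetilde B(s^{*})$ on the unit sphere. A spherical helix is a curve on the sphere which is a (general) helix, i.e. the ratio of its torsion to its curvature is constant. *)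

(* Defs.v *)
From Stdlib Require Import Reals.
From Coquelicot Require Import Coquelicot.
Open Scope R_scope.

Definition vec3 : Type := (R * R * R)%type.

Definition pr1 (u : vec3) : R := fst (fst u).
Definition pr2 (u : vec3) : R := snd (fst u).
Definition pr3 (u : vec3) : R := snd u.

Definition dot (u v : vec3) : R :=
  pr1 u * pr1 v + pr2 u * pr2 v + pr3 u * pr3 v.

Definition cross (u v : vec3) : vec3 :=
  (pr2 u * pr3 v - pr3 u * pr2 v,
   pr3 u * pr1 v - pr1 u * pr3 v,
   pr1 u * pr2 v - pr2 u * pr1 v).

Definition vnorm (u : vec3) : R := sqrt (dot u u).

(* Angle, in [0, PI/2], between the lines directed by nonzero u and v. *)
Definition line_angle (u v : vec3) : R :=
  acos (Rabs (dot u v) / (vnorm u * vnorm v)).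

(* All curves are total functions [R -> vec3], considered only on an open,
   possibly unbounded interval ]a, b[ of parameters. *)
Definition in_itv (a b : Rbar) (t : R) : Prop := Rbar_lt a t /\ Rbar_lt t b.

Definition smooth_on (a b : Rbar) (f : R -> R) : Prop :=
  forall (n : nat) (t : R), in_itv a b t -> ex_derive_n f n t.

Definition vderive (c : R -> vec3) (t : R) : vec3 :=
  (Derive (fun x => pr1 (c x)) t,
   Derive (fun x => pr2 (c x)) t,
   Derive (fun x => pr3 (c x)) t).

Definition speed (c : R -> vec3) (t : R) : R := vnorm (vderive c t).

(* Derivative of a field X along c with respect to the arclength of c, so that
   the Frenet apparatus below applies to any regular parameterization. *)
Definition arc_derive (c X : R -> vec3) (t : R) : vec3 :=
  scal (/ speed c t) (vderive X t).

Definition tangent (c : R -> vec3) : R -> vec3 := arc_derive c c.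

Definition curvature (c : R -> vec3) (t : R) : R :=
  vnorm (arc_derive c (tangent c) t).

Definition normal (c : R -> vec3) (t : R) : vec3 :=
  scal (/ curvature c t) (arc_derive c (tangent c) t).

Definition binormal (c : R -> vec3) (t : R) : vec3 :=
  cross (tangent c t) (normal c t).

(* Sign convention: dB/ds = - tau N. *)
Definition torsion (c : R -> vec3) (t : R) : R :=
  - dot (arc_derive c (binormal c) t) (normal c t).

(* Smooth regular curve with non-vanishing curvature. *)
Definition frenet_curve (a b : Rbar) (c : R -> vec3) : Prop :=
  smooth_on a b (fun t => pr1 (c t)) /\
  smooth_on a b (fun t => pr2 (c t)) /\
  smooth_on a b (fun t => pr3 (c t)) /\
  (forall t, in_itv a b t -> speed c t <> 0) /\
  (forall t, in_itv a b t -> curvature c t <> 0).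

Definition arclength_param (a b : Rbar) (c : R -> vec3) : Prop :=
  forall t, in_itv a b t -> speed c t = 1.

Definition const_ratio (a b : Rbar) (c : R -> vec3) : Prop :=
  exists k : R, forall t, in_itv a b t -> torsion c t / curvature c t = k.

Definition general_helix (a b : Rbar) (c : R -> vec3) : Prop :=
  frenet_curve a b c /\ const_ratio a b c.

Definition spherical_helix (a b : Rbar) (c : R -> vec3) : Prop :=
  (forall t, in_itv a b t -> vnorm (c t) = 1) /\ general_helix a b c.

Definition slant_helix (a b : Rbar) (c : R -> vec3) : Prop :=
  frenet_curve a b c /\
  exists (u : vec3) (theta : R), u <> zero /\
    forall t, in_itv a b t -> line_angle (normal c t) u = theta.

Definition non_helical (a b : Rbar) (c : R -> vec3) : Prop :=
  ~ const_ratio a b c.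

Definition non_planar (a b : Rbar) (c : R -> vec3) : Prop :=
  forall t, in_itv a b t -> torsion c t <> 0.

(* The quotients tau/kappa and tau'/kappa' are defined, non-zero and different
   at each point; for use with an arclength parameterization. *)
Definition admissible_quotients (a b : Rbar) (c : R -> vec3) : Prop :=
  forall t, in_itv a b t ->
    curvature c t <> 0 /\
    Derive (curvature c) t <> 0 /\
    torsion c t / curvature c t <> 0 /\
    Derive (torsion c) t / Derive (curvature c) t <> 0 /\
    torsion c t / curvature c t
      <> Derive (torsion c) t / Derive (curvature c) t.

(* phi is the correspondence of points, sending the parameter s of c on ]a, b[
   bijectively to the parameter of the mate m on ]a', b'[. *)
Definition bertrand_pair (a b a' b' : Rbar) (c m : R -> vec3) : Prop :=
  exists (phi : R -> R) (eps lam : R),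
    (forall s, in_itv a b s -> in_itv a' b' (phi s)) /\
    (forall s1 s2, in_itv a b s1 -> in_itv a b s2 ->
       phi s1 = phi s2 -> s1 = s2) /\
    (forall s', in_itv a' b' s' -> exists s, in_itv a b s /\ phi s = s') /\
    (eps = 1 \/ eps = -1) /\
    lam <> 0 /\
    (forall s, in_itv a b s ->
       normal c s = scal eps (normal m (phi s)) /\
       m (phi s) = plus (c s) (scal lam (normal c s))).

(* Main.v *)
(* The slant helix property only involves the principal normal lines, which the
   two curves of a Bertrand pair share (the correspondence being onto), so it
   passes from the curve to its mate.  For the mate, B' = - tau N makes the
   tangent line of the binormal indicatrix parallel to the principal normal
   line.  By Lancret's theorem the indicatrix is a general helix iff its tangent
   lines make a constant angle with a fixed line, which is to say that the mate
   is a slant helix. *)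

Require Import Defs.
From Stdlib Require Import Reals Lra Classical.
From Coquelicot Require Import Coquelicot.
Open Scope R_scope.

(** * Calculus on an open interval *)

Lemma locally_in_itv (a b : Rbar) (t : R) :
  in_itv a b t -> locally t (in_itv a b).
Proof.
  intros [Ha Hb]; unfold in_itv.
  apply filter_and.
  - exact (open_Rbar_gt' t a Ha).
  - exact (open_Rbar_lt' t b Hb).
Qed.

Lemma in_itv_between (a b : Rbar) (s t x : R) :
  in_itv a b s -> in_itv a b t -> s <= x <= t -> in_itv a b x.
Proof.
  intros [Has _] [_ Htb] [Hsx Hxt]; split.
  - now apply Rbar_lt_le_trans with s.
  - now apply Rbar_le_lt_trans with t.
Qed.

Lemma itv_derive_eq (a b : Rbar) (f g : R -> R) (t : R) :
  (forall x, in_itv a b x -> f x = g x) -> in_itv a b t ->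
  Derive f t = Derive g t.
Proof.
  intros H Ht; apply Derive_ext_loc.
  generalize (locally_in_itv a b t Ht); apply filter_imp; exact H.
Qed.

Lemma itv_derive0_const (a b : Rbar) (f : R -> R) (s t : R) :
  (forall x, in_itv a b x -> is_derive f x 0) ->
  in_itv a b s -> in_itv a b t -> f s = f t.
Proof.
  intros Hf Hs Ht.
  destruct (Rtotal_order s t) as [H | [-> | H]]; [| reflexivity | symmetry].
  - apply (eq_is_derive f); [| exact H].
    intros x Hx; apply Hf; exact (in_itv_between a b s t x Hs Ht Hx).
  - apply (eq_is_derive f); [| exact H].
    intros x Hx; apply Hf; exact (in_itv_between a b t s x Ht Hs Hx).
Qed.

(** Since [f * f] is constant, [f * f' = 0]; for [k <> 0] the function never vanishes, so [f' = 0].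
    This removes the absolute value that [line_angle] puts around the dot product. *)
Lemma itv_abs_const (a b : Rbar) (f : R -> R) (k : R) :
  (forall x, in_itv a b x -> ex_derive f x) ->
  (forall x, in_itv a b x -> Rabs (f x) = k) ->
  forall s t, in_itv a b s -> in_itv a b t -> f s = f t.
Proof.
  intros Df Hk s t Hs Ht.
  destruct (Req_dec k 0) as [Hk0 | Hk0].
  - assert (Z : forall x, in_itv a b x -> f x = 0).
    { intros x Hx. apply Rabs_eq_0. rewrite (Hk x Hx); exact Hk0. }
    now rewrite (Z s Hs), (Z t Ht).
  - apply (itv_derive0_const a b); trivial.
    intros x Hx.
    assert (D2 : Derive (fun y => f y * f y) x = 0).
    { rewrite (itv_derive_eq a b _ (fun _ => k * k) x); [apply Derive_const | | exact Hx].
      intros y Hy; rewrite <- (Hk y Hy), <- Rabs_mult.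
      symmetry; apply Rabs_pos_eq; nra. }
    rewrite Derive_mult in D2 by now apply Df.
    assert (Hfx : f x <> 0).
    { intros E; apply Hk0; rewrite <- (Hk x Hx), E; apply Rabs_R0. }
    replace 0 with (Derive f x); [apply Derive_correct; now apply Df |].
    apply Rmult_eq_reg_l with (f x); lra.
Qed.

(** * Smooth functions and their closure properties *)

(* This class is closed under derivation, as differentiating any of its members
   only uses the same operations; hence all its members are smooth. *)
Inductive generated (a b : Rbar) : (R -> R) -> Prop :=
| gen_smooth f : smooth_on a b f -> generated a b f
| gen_plus f g : generated a b f -> generated a b g ->
    generated a b (fun t => f t + g t)
| gen_mult f g : generated a b f -> generated a b g ->
    generated a b (fun t => f t * g t)
| gen_inv f : generated a b f -> (forall t, in_itv a b t -> f t <> 0) ->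
    generated a b (fun t => / f t)
| gen_sqrt f : generated a b f -> (forall t, in_itv a b t -> 0 < f t) ->
    generated a b (fun t => sqrt (f t)).

Lemma smooth_const (a b : Rbar) (k : R) : smooth_on a b (fun _ => k).
Proof. intros n t _; apply ex_derive_n_const. Qed.

Lemma smooth_ex_derive (a b : Rbar) (f : R -> R) (t : R) :
  smooth_on a b f -> in_itv a b t -> ex_derive f t.
Proof. intros Hf Ht; exact (Hf 1%nat t Ht). Qed.

Lemma smooth_derive (a b : Rbar) (f : R -> R) :
  smooth_on a b f -> smooth_on a b (Derive f).
Proof.
  intros Hf [|n] t Ht; [exact I |].
  assert (E : forall m x, Derive_n (Derive f) m x = Derive_n f (S m) x).
  { intros m x; change (Derive f) with (Derive_n f 1).
    rewrite Derive_n_comp; now rewrite Nat.add_1_r. }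
  simpl; apply ex_derive_ext with (Derive_n f (S n)).
  - intros x; symmetry; apply E.
  - exact (Hf (S (S n)) t Ht).
Qed.

(** The derivative is claimed on the interval only: outside it, a denominator may vanish or the
    argument of a root may be negative. *)
Lemma generated_derive (a b : Rbar) (f : R -> R) :
  generated a b f ->
  exists g, generated a b g /\ forall t, in_itv a b t -> is_derive f t (g t).
Proof.
  induction 1 as [f Hf | f g Gf [f' [Gf' Hf]] Gg [g' [Gg' Hg]]
    | f g Gf [f' [Gf' Hf]] Gg [g' [Gg' Hg]]
    | f Gf [f' [Gf' Hf]] Hn | f Gf [f' [Gf' Hf]] Hp].
  - exists (Derive f); split; [apply gen_smooth, smooth_derive, Hf |].
    intros t Ht; apply Derive_correct, (smooth_ex_derive a b); trivial.
  - exists (fun t => f' t + g' t); split; [now apply gen_plus |].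
    intros t Ht; apply (is_derive_plus f g); auto.
  - exists (fun t => f' t * g t + f t * g' t); split.
    { now apply gen_plus; apply gen_mult. }
    intros t Ht; apply (is_derive_mult f g); auto.
    intros; apply Rmult_comm.
  (* This is [- f' / f ^ 2], rewritten with the constructors of [generated] alone. *)
  - exists (fun t => (-1 * f' t) * (/ f t * / f t)); split.
    { repeat apply gen_mult; trivial.
      - apply gen_smooth, smooth_const.
      - now apply gen_inv.
      - now apply gen_inv. }
    intros t Ht.
    replace (_ * _) with (- f' t / f t ^ 2) by (field; auto).
    apply is_derive_inv; auto.
  - assert (Hs : forall t, in_itv a b t -> 0 < sqrt (f t)).
    { intros t Ht; apply sqrt_lt_R0; auto. }
    exists (fun t => f' t * / (2 * sqrt (f t))); split.
    { apply gen_mult; [trivial | apply gen_inv].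
      - apply gen_mult; [apply gen_smooth, smooth_const | now apply gen_sqrt].
      - intros t Ht; specialize (Hs t Ht); lra. }
    intros t Ht; apply (is_derive_sqrt f t (f' t)); auto.
Qed.

(** By induction on [n], the [n]-th derivative agrees on the interval with a member of the class,
    which is itself differentiable there. The interval being open, this agreement suffices to
    transfer differentiability. *)
Lemma generated_smooth (a b : Rbar) (f : R -> R) :
  generated a b f -> smooth_on a b f.
Proof.
  intros Gf.
  assert (H : forall n, exists g, generated a b g /\
            forall t, in_itv a b t -> Derive_n f n t = g t).
  { induction n as [|n [g [Gg Hg]]]; [now exists f |].
    destruct (generated_derive a b g Gg) as [g' [Gg' Hg']].
    exists g'; split; [exact Gg' |].
    intros t Ht; simpl; rewrite (itv_derive_eq a b _ g t Hg Ht).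
    apply is_derive_unique; auto. }
  intros [|n] t Ht; [exact I |].
  destruct (H n) as [g [Gg Hg]].
  destruct (generated_derive a b g Gg) as [g' [_ Hg']].
  apply ex_derive_ext_loc with g.
  - generalize (locally_in_itv a b t Ht); apply filter_imp.
    intros x Hx; symmetry; auto.
  - exists (g' t); auto.
Qed.

Lemma smooth_plus (a b : Rbar) (f g : R -> R) :
  smooth_on a b f -> smooth_on a b g -> smooth_on a b (fun t => f t + g t).
Proof. intros; apply generated_smooth, gen_plus; now apply gen_smooth. Qed.

Lemma smooth_mult (a b : Rbar) (f g : R -> R) :
  smooth_on a b f -> smooth_on a b g -> smooth_on a b (fun t => f t * g t).
Proof. intros; apply generated_smooth, gen_mult; now apply gen_smooth. Qed.

Lemma smooth_opp (a b : Rbar) (f : R -> R) :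
  smooth_on a b f -> smooth_on a b (fun t => - f t).
Proof.
  intros Hf n t Ht; apply ex_derive_n_opp; now apply Hf.
Qed.

Lemma smooth_minus (a b : Rbar) (f g : R -> R) :
  smooth_on a b f -> smooth_on a b g -> smooth_on a b (fun t => f t - g t).
Proof. intros; apply smooth_plus; [|apply smooth_opp]; assumption. Qed.

Lemma smooth_inv (a b : Rbar) (f : R -> R) :
  smooth_on a b f -> (forall t, in_itv a b t -> f t <> 0) ->
  smooth_on a b (fun t => / f t).
Proof. intros; apply generated_smooth, gen_inv; [now apply gen_smooth | trivial]. Qed.

Lemma smooth_sqrt (a b : Rbar) (f : R -> R) :
  smooth_on a b f -> (forall t, in_itv a b t -> 0 < f t) ->
  smooth_on a b (fun t => sqrt (f t)).
Proof. intros; apply generated_smooth, gen_sqrt; [now apply gen_smooth | trivial]. Qed.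

Definition smooth_field (a b : Rbar) (X : R -> vec3) : Prop :=
  smooth_on a b (fun t => pr1 (X t)) /\
  smooth_on a b (fun t => pr2 (X t)) /\
  smooth_on a b (fun t => pr3 (X t)).

(** * Vector algebra, norms and angles between lines *)

Lemma dot_comm (u v : vec3) : dot u v = dot v u.
Proof. unfold dot; ring. Qed.

Lemma dot_scal_l (k : R) (u v : vec3) : dot (scal k u) v = k * dot u v.
Proof.
  destruct u as [[u1 u2] u3].
  unfold dot, pr1, pr2, pr3, scal; simpl; unfold scal; simpl; unfold mult; simpl; ring.
Qed.

Lemma dot_scal_r (k : R) (u v : vec3) : dot u (scal k v) = k * dot u v.
Proof. now rewrite dot_comm, dot_scal_l, dot_comm. Qed.

Lemma dot_plus_r (u v w : vec3) : dot u (plus v w) = dot u v + dot u w.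
Proof.
  destruct v as [[v1 v2] v3], w as [[w1 w2] w3].
  unfold dot, pr1, pr2, pr3, plus; simpl; unfold plus; simpl; ring.
Qed.

Lemma dot_zero_r (u : vec3) : dot u zero = 0.
Proof.
  unfold dot, pr1, pr2, pr3, zero; simpl; unfold zero; simpl; ring.
Qed.

Lemma dot_cross_l (u v : vec3) : dot u (cross u v) = 0.
Proof. unfold dot, cross, pr1, pr2, pr3; simpl; ring. Qed.

Lemma dot_cross_r (u v : vec3) : dot v (cross u v) = 0.
Proof. unfold dot, cross, pr1, pr2, pr3; simpl; ring. Qed.

(** Lagrange's identity, the source of both the Cauchy-Schwarz inequality and the unit length of the
    binormal. *)
Lemma dot_cross_cross (u v : vec3) :
  dot (cross u v) (cross u v) = dot u u * dot v v - dot u v * dot u v.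
Proof. unfold dot, cross, pr1, pr2, pr3; simpl; ring. Qed.

Lemma dot_self_ge0 (u : vec3) : 0 <= dot u u.
Proof. unfold dot; nra. Qed.

Lemma dot_self_eq0 (u : vec3) : dot u u = 0 -> u = zero.
Proof.
  destruct u as [[x y] z]; unfold dot, pr1, pr2, pr3; simpl; intros H.
  assert (x = 0) by nra; assert (y = 0) by nra; assert (z = 0) by nra.
  now subst.
Qed.

Lemma vnorm_sqr (u : vec3) : vnorm u * vnorm u = dot u u.
Proof. apply sqrt_sqrt, dot_self_ge0. Qed.

Lemma vnorm_scal (k : R) (u : vec3) : vnorm (scal k u) = Rabs k * vnorm u.
Proof.
  unfold vnorm; rewrite dot_scal_l, dot_scal_r, <- Rmult_assoc.
  rewrite sqrt_mult by (try nra; apply dot_self_ge0).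
  f_equal; exact (sqrt_Rsqr_abs k).
Qed.

Lemma vnorm_eq1 (u : vec3) : vnorm u = 1 <-> dot u u = 1.
Proof.
  split; intros H.
  - rewrite <- vnorm_sqr, H; ring.
  - unfold vnorm; rewrite H; apply sqrt_1.
Qed.

Lemma vnorm_neq0_gt0 (u : vec3) : vnorm u <> 0 -> 0 < dot u u.
Proof.
  intros H; rewrite <- vnorm_sqr.
  apply (Rsqr_pos_lt _ H).
Qed.

Lemma vnorm_gt0 (u : vec3) : u <> zero -> 0 < vnorm u.
Proof.
  intros H; apply sqrt_lt_R0.
  destruct (dot_self_ge0 u) as [Hu | Hu]; [exact Hu |].
  now destruct H; apply dot_self_eq0.
Qed.

Lemma vnorm_normalize (u : vec3) : vnorm u <> 0 -> vnorm (scal (/ vnorm u) u) = 1.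
Proof.
  intros H; rewrite vnorm_scal, Rabs_inv, Rabs_pos_eq by apply sqrt_pos.
  now field.
Qed.

Lemma cauchy_schwarz (u v : vec3) : Rabs (dot u v) <= vnorm u * vnorm v.
Proof.
  assert (H := dot_self_ge0 (cross u v)); rewrite dot_cross_cross in H.
  assert (Hu : 0 <= vnorm u) by apply sqrt_pos.
  assert (Hv : 0 <= vnorm v) by apply sqrt_pos.
  rewrite <- !vnorm_sqr in H.
  rewrite <- (Rabs_pos_eq (vnorm u * vnorm v)) by nra.
  apply Rsqr_le_abs_0; unfold Rsqr; nra.
Qed.

(* Cramer's rule in the basis (u, v, u x v), whose determinant is 1. *)
Lemma dot_orthonormal_frame (u v x y : vec3) :
  dot u u = 1 -> dot v v = 1 -> dot u v = 0 ->
  dot x y = dot x u * dot y u + dot x v * dot y v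
            + dot x (cross u v) * dot y (cross u v).
Proof.
  intros Hu Hv Huv.
  assert (D : dot (cross u v) (cross u v) = 1).
  { rewrite dot_cross_cross, Hu, Hv, Huv; ring. }
  assert (E : dot (cross u v) (cross u v) * dot x y =
    dot x (cross v (cross u v)) * dot y u
    + dot x (cross (cross u v) u) * dot y v
    + dot x (cross u v) * dot y (cross u v)).
  { unfold dot, cross, pr1, pr2, pr3; simpl; ring. }
  (* The triple product expansion reduces the two remaining double cross products to [u] and [v]
     when these are orthonormal. *)
  assert (E1 : dot x (cross v (cross u v)) = dot v v * dot x u - dot u v * dot x v).
  { unfold dot, cross, pr1, pr2, pr3; simpl; ring. }
  assert (E2 : dot x (cross (cross u v) u) = dot u u * dot x v - dot u v * dot x u).
  { unfold dot, cross, pr1, pr2, pr3; simpl; ring. }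
  rewrite D, E1, E2, Hu, Hv, Huv in E; lra.
Qed.

Lemma line_angle_scal_sign (eps : R) (u v : vec3) :
  Rabs eps = 1 -> line_angle (scal eps u) v = line_angle u v.
Proof.
  intros H; unfold line_angle.
  now rewrite dot_scal_l, Rabs_mult, vnorm_scal, H, !Rmult_1_l.
Qed.

(** By Cauchy-Schwarz the argument of [acos] lies in [0, 1], where [cos] undoes [acos]. *)
Lemma cos_line_angle (u v : vec3) :
  u <> zero -> v <> zero ->
  Rabs (dot u v) = cos (line_angle u v) * (vnorm u * vnorm v).
Proof.
  intros Hu Hv; unfold line_angle.
  apply vnorm_gt0 in Hu; apply vnorm_gt0 in Hv.
  assert (Huv : 0 < vnorm u * vnorm v) by nra.
  rewrite cos_acos; [field; lra |].
  assert (H := cauchy_schwarz u v); assert (H0 := Rabs_pos (dot u v)).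
  split.
  - apply Rle_trans with 0; [lra |].
    apply Rdiv_le_0_compat; lra.
  - apply Rle_div_l; lra.
Qed.

(** Testing against an arbitrary [w] turns vector identities into real ones, within reach of [ring]
    and [field]. The Frenet formulas below are stated in this tested form. *)
Lemma dot_ext (u v : vec3) : (forall w, dot u w = dot v w) -> u = v.
Proof.
  destruct u as [[u1 u2] u3], v as [[v1 v2] v3]; intros H.
  assert (H1 := H (1, 0, 0)); assert (H2 := H (0, 1, 0)); assert (H3 := H (0, 0, 1)).
  unfold dot, pr1, pr2, pr3 in H1, H2, H3; simpl in H1, H2, H3.
  f_equal; [f_equal |]; lra.
Qed.

(** * Smooth vector fields along a curve and their derivatives *)

Lemma smooth_dot (a b : Rbar) (X Y : R -> vec3) :
  smooth_field a b X -> smooth_field a b Y ->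
  smooth_on a b (fun t => dot (X t) (Y t)).
Proof.
  intros [X1 [X2 X3]] [Y1 [Y2 Y3]]; unfold dot.
  apply smooth_plus; [apply smooth_plus |]; now apply smooth_mult.
Qed.

Lemma smooth_cross (a b : Rbar) (X Y : R -> vec3) :
  smooth_field a b X -> smooth_field a b Y ->
  smooth_field a b (fun t => cross (X t) (Y t)).
Proof.
  intros [X1 [X2 X3]] [Y1 [Y2 Y3]]; repeat split; unfold cross, pr1, pr2, pr3; simpl;
    apply smooth_minus; now apply smooth_mult.
Qed.

Lemma smooth_scal (a b : Rbar) (k : R -> R) (X : R -> vec3) :
  smooth_on a b k -> smooth_field a b X ->
  smooth_field a b (fun t => scal (k t) (X t)).
Proof.
  intros Hk [X1 [X2 X3]]; repeat split.
  - exact (smooth_mult a b k _ Hk X1).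
  - exact (smooth_mult a b k _ Hk X2).
  - exact (smooth_mult a b k _ Hk X3).
Qed.

Lemma smooth_vnorm (a b : Rbar) (X : R -> vec3) :
  smooth_field a b X -> (forall t, in_itv a b t -> vnorm (X t) <> 0) ->
  smooth_on a b (fun t => vnorm (X t)).
Proof.
  intros HX Hn; unfold vnorm; apply smooth_sqrt; [now apply smooth_dot |].
  intros t Ht; apply vnorm_neq0_gt0; auto.
Qed.

Lemma smooth_vderive (a b : Rbar) (X : R -> vec3) :
  smooth_field a b X -> smooth_field a b (vderive X).
Proof.
  intros [X1 [X2 X3]]; repeat split.
  - exact (smooth_derive a b _ X1).
  - exact (smooth_derive a b _ X2).
  - exact (smooth_derive a b _ X3).
Qed.

Lemma smooth_fixed (a b : Rbar) (u : vec3) : smooth_field a b (fun _ => u).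
Proof. repeat split; apply smooth_const. Qed.

Lemma derive_dot (a b : Rbar) (X Y : R -> vec3) (t : R) :
  smooth_field a b X -> smooth_field a b Y -> in_itv a b t ->
  Derive (fun x => dot (X x) (Y x)) t
  = dot (vderive X t) (Y t) + dot (X t) (vderive Y t).
Proof.
  intros [X1 [X2 X3]] [Y1 [Y2 Y3]] Ht.
  assert (P : forall f g, smooth_on a b f -> smooth_on a b g ->
    is_derive (fun x => f x * g x) t (Derive f t * g t + f t * Derive g t)).
  { intros f g Hf Hg; apply (is_derive_mult f g); [| | intros; apply Rmult_comm];
      now apply Derive_correct, (smooth_ex_derive a b). }
  assert (Q := is_derive_plus _ _ _ _ _
    (is_derive_plus _ _ _ _ _ (P _ _ X1 Y1) (P _ _ X2 Y2)) (P _ _ X3 Y3)).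
  apply is_derive_unique in Q; etransitivity; [exact Q |].
  unfold dot, vderive, pr1, pr2, pr3, plus; simpl; ring.
Qed.

Lemma arc_derive_dot (a b : Rbar) (c X Y : R -> vec3) (t : R) :
  smooth_field a b X -> smooth_field a b Y -> in_itv a b t ->
  dot (arc_derive c X t) (Y t) + dot (X t) (arc_derive c Y t)
  = / speed c t * Derive (fun x => dot (X x) (Y x)) t.
Proof.
  intros HX HY Ht; rewrite (derive_dot a b) by trivial.
  unfold arc_derive; rewrite dot_scal_l, dot_scal_r; ring.
Qed.

(** The product rule for a constant dot product. Applied to pairs of frame vectors, it gives the
    skew-symmetry of the Frenet equations. *)
Lemma arc_derive_dot_const (a b : Rbar) (c X Y : R -> vec3) (k t : R) :
  smooth_field a b X -> smooth_field a b Y ->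
  (forall x, in_itv a b x -> dot (X x) (Y x) = k) -> in_itv a b t ->
  dot (arc_derive c X t) (Y t) + dot (X t) (arc_derive c Y t) = 0.
Proof.
  intros HX HY Hk Ht; rewrite (arc_derive_dot a b) by trivial.
  rewrite (itv_derive_eq a b _ (fun _ => k) t Hk Ht), Derive_const; ring.
Qed.

Lemma arc_derive_dot_fixed (a b : Rbar) (c X : R -> vec3) (u : vec3) (t : R) :
  smooth_field a b X -> in_itv a b t ->
  dot (arc_derive c X t) u = / speed c t * Derive (fun x => dot (X x) u) t.
Proof.
  intros HX Ht.
  assert (H := arc_derive_dot a b c X (fun _ => u) t HX (smooth_fixed a b u) Ht).
  simpl in H; rewrite <- H.
  replace (arc_derive c (fun _ => u) t) with (zero : vec3); [rewrite dot_zero_r; ring |].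
  unfold arc_derive, vderive; rewrite !Derive_const.
  apply dot_ext; intros w; rewrite dot_scal_l.
  rewrite (dot_comm zero), dot_zero_r; unfold dot, pr1, pr2, pr3; simpl; ring.
Qed.

Lemma dot_fixed_const (a b : Rbar) (c X : R -> vec3) (u : vec3) (s t : R) :
  smooth_field a b X -> (forall x, in_itv a b x -> speed c x <> 0) ->
  (forall x, in_itv a b x -> dot (arc_derive c X x) u = 0) ->
  in_itv a b s -> in_itv a b t -> dot (X s) u = dot (X t) u.
Proof.
  intros HX Hv H0 Hs Ht.
  apply (itv_derive0_const a b (fun x => dot (X x) u)); trivial.
  intros x Hx; specialize (H0 x Hx); specialize (Hv x Hx).
  rewrite (arc_derive_dot_fixed a b) in H0 by trivial.
  replace 0 with (Derive (fun x => dot (X x) u) x).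
  - apply Derive_correct, (smooth_ex_derive a b); [| exact Hx].
    apply smooth_dot; [exact HX | apply smooth_fixed].
  - apply Rmult_integral in H0; destruct H0 as [H0 | H0]; [| exact H0].
    now apply Rinv_neq_0_compat in Hv.
Qed.

(** * The Frenet frame and the Frenet formulas *)

Lemma smooth_arc_derive (a b : Rbar) (c X : R -> vec3) :
  frenet_curve a b c -> smooth_field a b X -> smooth_field a b (arc_derive c X).
Proof.
  intros [C1 [C2 [C3 [Hv _]]]] HX; unfold arc_derive.
  apply smooth_scal; [| now apply smooth_vderive].
  apply smooth_inv; [| exact Hv].
  apply smooth_vnorm; [| exact Hv].
  now apply smooth_vderive.
Qed.

Lemma smooth_tangent (a b : Rbar) (c : R -> vec3) :
  frenet_curve a b c -> smooth_field a b (tangent c).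
Proof.
  intros Hc; apply (smooth_arc_derive a b c c Hc).
  destruct Hc as [C1 [C2 [C3 _]]]; exact (conj C1 (conj C2 C3)).
Qed.

Lemma smooth_normal (a b : Rbar) (c : R -> vec3) :
  frenet_curve a b c -> smooth_field a b (normal c).
Proof.
  intros Hc; unfold normal.
  assert (HT' := smooth_arc_derive a b c _ Hc (smooth_tangent a b c Hc)).
  destruct Hc as [_ [_ [_ [_ Hk]]]].
  apply smooth_scal; [| exact HT'].
  apply smooth_inv; [| exact Hk].
  now apply smooth_vnorm.
Qed.

Lemma smooth_binormal (a b : Rbar) (c : R -> vec3) :
  frenet_curve a b c -> smooth_field a b (binormal c).
Proof.
  intros Hc; apply smooth_cross; [now apply smooth_tangent | now apply smooth_normal].
Qed.

Lemma vderive_arc (c X : R -> vec3) (t : R) :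
  speed c t <> 0 -> vderive X t = scal (speed c t) (arc_derive c X t).
Proof.
  intros Hv; apply dot_ext; intros w; unfold arc_derive.
  rewrite !dot_scal_l; now field.
Qed.

Lemma tangent_unit (a b : Rbar) (c : R -> vec3) (t : R) :
  frenet_curve a b c -> in_itv a b t -> dot (tangent c t) (tangent c t) = 1.
Proof.
  intros [_ [_ [_ [Hv _]]]] Ht; apply vnorm_eq1.
  apply (vnorm_normalize (vderive c t)); exact (Hv t Ht).
Qed.

Lemma normal_unit (a b : Rbar) (c : R -> vec3) (t : R) :
  frenet_curve a b c -> in_itv a b t -> dot (normal c t) (normal c t) = 1.
Proof.
  intros [_ [_ [_ [_ Hk]]]] Ht; apply vnorm_eq1.
  apply (vnorm_normalize (arc_derive c (tangent c) t)); exact (Hk t Ht).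
Qed.

(** The formula T' = kappa N, which is the definition of [normal] once the non-zero curvature is
    cleared. *)
Lemma arc_derive_tangent (a b : Rbar) (c : R -> vec3) (t : R) (w : vec3) :
  frenet_curve a b c -> in_itv a b t ->
  dot (arc_derive c (tangent c) t) w = curvature c t * dot (normal c t) w.
Proof.
  intros [_ [_ [_ [_ Hk]]]] Ht; unfold normal; rewrite dot_scal_l.
  field; exact (Hk t Ht).
Qed.

(** Differentiating T . T = 1 gives T' . T = 0, and N is a multiple of T'. *)
Lemma tangent_normal (a b : Rbar) (c : R -> vec3) (t : R) :
  frenet_curve a b c -> in_itv a b t -> dot (tangent c t) (normal c t) = 0.
Proof.
  intros Hc Ht; assert (HT := smooth_tangent a b c Hc).
  assert (H := arc_derive_dot_const a b c _ _ 1 t HT HT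
    (fun x Hx => tangent_unit a b c x Hc Hx) Ht).
  unfold normal; rewrite dot_scal_r.
  rewrite (dot_comm (arc_derive _ _ _)) in H.
  replace (dot _ _) with 0 by lra; ring.
Qed.

Lemma binormal_unit (a b : Rbar) (c : R -> vec3) (t : R) :
  frenet_curve a b c -> in_itv a b t -> dot (binormal c t) (binormal c t) = 1.
Proof.
  intros Hc Ht; unfold binormal.
  rewrite dot_cross_cross, (tangent_unit a b), (normal_unit a b), (tangent_normal a b)
    by trivial; ring.
Qed.

Lemma tangent_binormal (c : R -> vec3) (t : R) : dot (tangent c t) (binormal c t) = 0.
Proof. apply dot_cross_l. Qed.

Lemma normal_binormal (c : R -> vec3) (t : R) : dot (normal c t) (binormal c t) = 0.
Proof. apply dot_cross_r. Qed.

Lemma frenet_frame (a b : Rbar) (c : R -> vec3) (t : R) (v w : vec3) :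
  frenet_curve a b c -> in_itv a b t ->
  dot v w = dot v (tangent c t) * dot w (tangent c t)
            + dot v (normal c t) * dot w (normal c t)
            + dot v (binormal c t) * dot w (binormal c t).
Proof.
  intros Hc Ht; apply dot_orthonormal_frame.
  - now apply (tangent_unit a b).
  - now apply (normal_unit a b).
  - now apply (tangent_normal a b).
Qed.

(** The formula B' = - tau N. The B-component of B' vanishes because B is a unit vector, the
    T-component because T . B = 0 and T' is parallel to N; the N-component is - tau by definition of
    [torsion]. *)
Lemma arc_derive_binormal (a b : Rbar) (c : R -> vec3) (t : R) (w : vec3) :
  frenet_curve a b c -> in_itv a b t ->
  dot (arc_derive c (binormal c) t) w = - torsion c t * dot (normal c t) w.
Proof.
  intros Hc Ht.
  assert (HT := smooth_tangent a b c Hc).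
  assert (HB := smooth_binormal a b c Hc).
  assert (BB := arc_derive_dot_const a b c _ _ 1 t HB HB
    (fun x Hx => binormal_unit a b c x Hc Hx) Ht).
  assert (TB := arc_derive_dot_const a b c _ _ 0 t HT HB
    (fun x _ => tangent_binormal c x) Ht).
  rewrite (arc_derive_tangent a b), normal_binormal in TB by trivial.
  rewrite (dot_comm (binormal c t)) in BB.
  rewrite (dot_comm (tangent c t)) in TB.
  rewrite (frenet_frame a b c t _ w) by trivial.
  replace (dot (arc_derive c (binormal c) t) (tangent c t)) with 0 by lra.
  replace (dot (arc_derive c (binormal c) t) (binormal c t)) with 0 by lra.
  unfold torsion; rewrite (dot_comm w (normal c t)); ring.
Qed.

(** The components of N' come from differentiating N . N = 1, T . N = 0 and B . N = 0 with the other
    two formulas. *)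
Lemma arc_derive_normal (a b : Rbar) (c : R -> vec3) (t : R) (w : vec3) :
  frenet_curve a b c -> in_itv a b t ->
  dot (arc_derive c (normal c) t) w
  = - curvature c t * dot (tangent c t) w + torsion c t * dot (binormal c t) w.
Proof.
  intros Hc Ht.
  assert (HT := smooth_tangent a b c Hc).
  assert (HN := smooth_normal a b c Hc).
  assert (HB := smooth_binormal a b c Hc).
  assert (NN := arc_derive_dot_const a b c _ _ 1 t HN HN
    (fun x Hx => normal_unit a b c x Hc Hx) Ht).
  assert (TN := arc_derive_dot_const a b c _ _ 0 t HT HN
    (fun x Hx => tangent_normal a b c x Hc Hx) Ht).
  assert (BN := arc_derive_dot_const a b c _ _ 0 t HB HN
    (fun x _ => eq_trans (dot_comm _ _) (normal_binormal c x)) Ht).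
  rewrite (arc_derive_tangent a b), (normal_unit a b) in TN by trivial.
  rewrite (arc_derive_binormal a b), (normal_unit a b) in BN by trivial.
  rewrite (dot_comm (tangent c t)) in TN.
  rewrite (dot_comm (normal c t)) in NN.
  rewrite (dot_comm (binormal c t)) in BN.
  rewrite (frenet_frame a b c t _ w) by trivial.
  replace (dot (arc_derive c (normal c) t) (tangent c t)) with (- curvature c t) by lra.
  replace (dot (arc_derive c (normal c) t) (normal c t)) with 0 by lra.
  replace (dot (arc_derive c (normal c) t) (binormal c t)) with (torsion c t) by lra.
  rewrite (dot_comm w (tangent c t)), (dot_comm w (binormal c t)); ring.
Qed.

(** * Lancret's theorem on general helices *)

Lemma unit_neq0 (u : vec3) : dot u u = 1 -> u <> zero.
Proof. intros H E; rewrite E, dot_zero_r in H; lra. Qed.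

(* Lancret's theorem. The axis of a curve with torsion k * curvature is the
   vector k T + B, whose derivative (k kappa - tau) N vanishes. *)
Lemma const_ratio_iff_tangent_angle (a b : Rbar) (c : R -> vec3) (t0 : R) :
  frenet_curve a b c -> in_itv a b t0 ->
  const_ratio a b c <->
  exists (u : vec3) (theta : R), u <> zero /\
    forall t, in_itv a b t -> line_angle (tangent c t) u = theta.
Proof.
  intros Hc Ht0.
  assert (HT := smooth_tangent a b c Hc).
  assert (HN := smooth_normal a b c Hc).
  assert (HB := smooth_binormal a b c Hc).
  assert (Hcc := Hc); destruct Hcc as [_ [_ [_ [Hv Hk]]]].
  split.
  - intros [k Hr].
    set (u := plus (scal k (tangent c t0)) (binormal c t0)).
    assert (Hu : forall t, in_itv a b t -> dot (tangent c t) u = k).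
    (* With [v] frozen, the function (k T + B) . v has zero derivative. Its value at [t0] is
       [dot u v], and its value at [t] is [k]. *)
    { intros t Ht; unfold u; set (v := tangent c t).
      assert (E : forall x, in_itv a b x ->
        is_derive (fun x => k * dot (tangent c x) v + dot (binormal c x) v) x 0).
      { intros x Hx.
        assert (DT : ex_derive (fun y => dot (tangent c y) v) x).
        { apply (smooth_ex_derive a b); [| exact Hx].
          apply smooth_dot; [exact HT | apply smooth_fixed]. }
        assert (DB : ex_derive (fun y => dot (binormal c y) v) x).
        { apply (smooth_ex_derive a b); [| exact Hx].
          apply smooth_dot; [exact HB | apply smooth_fixed]. }
        assert (ET := arc_derive_tangent a b c x v Hc Hx).
        assert (EB := arc_derive_binormal a b c x v Hc Hx).
        rewrite (arc_derive_dot_fixed a b) in ET by trivial.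
        rewrite (arc_derive_dot_fixed a b) in EB by trivial.
        specialize (Hv x Hx); specialize (Hk x Hx); specialize (Hr x Hx).
        assert (Et : torsion c x = k * curvature c x) by (rewrite <- Hr; now field).
        replace 0 with (k * Derive (fun y => dot (tangent c y) v) x
                        + Derive (fun y => dot (binormal c y) v) x).
        - apply (is_derive_plus (fun x => k * dot (tangent c x) v)).
          + apply is_derive_scal; now apply Derive_correct.
          + now apply Derive_correct.
        - apply Rmult_eq_reg_l with (/ speed c x); [| now apply Rinv_neq_0_compat].
          rewrite Rmult_plus_distr_l, (Rmult_comm k), <- Rmult_assoc, ET, EB, Et.
          ring. }
      assert (E' := itv_derive0_const a b _ t0 t E Ht0 Ht); simpl in E'.
      rewrite dot_comm, (dot_comm _ v), dot_plus_r, dot_scal_r, !(dot_comm v), E'.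
      unfold v; rewrite (tangent_unit a b), (dot_comm (binormal c t)), tangent_binormal
        by trivial; ring. }
    (* As T is a unit vector with T . u = k, this is [line_angle] unfolded. The axis is non-zero
       because its dot product with B at [t0] is 1. *)
    exists u, (acos (Rabs k / vnorm u)); split.
    + intros E.
      assert (H : dot (binormal c t0) u = 1).
      { unfold u; rewrite dot_plus_r, dot_scal_r, dot_comm, tangent_binormal.
        rewrite (binormal_unit a b) by trivial; ring. }
      rewrite E, dot_zero_r in H; lra.
    + intros t Ht; unfold line_angle.
      rewrite (Hu t Ht), (proj2 (vnorm_eq1 _) (tangent_unit a b c t Hc Ht)).
      now rewrite Rmult_1_l.
  - intros [u [theta [Hu0 Hu]]].
    (* Converse: T . u is constant in absolute value, hence constant, and differentiating it gives
       kappa (N . u) = 0. Then B . u is constant too. *)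
    assert (Tabs : forall t, in_itv a b t ->
              Rabs (dot (tangent c t) u) = cos theta * vnorm u).
    { intros t Ht.
      rewrite cos_line_angle, (Hu t Ht) by
        (trivial; apply unit_neq0; now apply (tangent_unit a b)).
      rewrite (proj2 (vnorm_eq1 _) (tangent_unit a b c t Hc Ht)); ring. }
    assert (DT : forall t, in_itv a b t -> ex_derive (fun t => dot (tangent c t) u) t).
    { intros t Ht; apply (smooth_ex_derive a b); [| exact Ht].
      apply smooth_dot; [exact HT | apply smooth_fixed]. }
    assert (T1 := fun t Ht => itv_abs_const a b _ _ DT Tabs t t0 Ht Ht0); simpl in T1.
    assert (N0 : forall t, in_itv a b t -> dot (normal c t) u = 0).
    { intros t Ht.
      assert (E := arc_derive_tangent a b c t u Hc Ht).
      rewrite (arc_derive_dot_fixed a b) in E by trivial.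
      rewrite (itv_derive_eq a b _ (fun _ => dot (tangent c t0) u) t T1 Ht) in E.
      rewrite Derive_const, Rmult_0_r in E.
      symmetry in E; apply Rmult_integral in E; destruct E as [E | E]; [| exact E].
      now destruct (Hk t Ht). }
    assert (B1 : forall t, in_itv a b t -> dot (binormal c t) u = dot (binormal c t0) u).
    { intros t Ht; apply (dot_fixed_const a b c); trivial.
      intros x Hx; rewrite (arc_derive_binormal a b), N0 by trivial; ring. }
    (* Differentiating N . u = 0 relates tau and kappa through the two constants B . u and T . u. *)
    assert (R0 : forall t, in_itv a b t ->
      torsion c t * dot (binormal c t0) u = curvature c t * dot (tangent c t0) u).
    { intros t Ht.
      assert (E := arc_derive_normal a b c t u Hc Ht).
      rewrite (arc_derive_dot_fixed a b) in E by trivial.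
      rewrite (itv_derive_eq a b _ (fun _ => 0) t N0 Ht), Derive_const, Rmult_0_r in E.
      rewrite (T1 t Ht), (B1 t Ht) in E; lra. }
    (* If B . u were 0, so would be T . u since kappa does not vanish; all components of [u] in the
       frame would then be 0. *)
    assert (Hl : dot (binormal c t0) u <> 0).
    { intros E; assert (E0 := R0 t0 Ht0).
      rewrite E, Rmult_0_r in E0.
      symmetry in E0; apply Rmult_integral in E0; destruct E0 as [E0 | E0].
      - now destruct (Hk t0 Ht0).
      - apply Hu0, dot_self_eq0; rewrite (frenet_frame a b c t0) by trivial.
        rewrite !(dot_comm u), E, E0, N0 by trivial; ring. }
    exists (dot (tangent c t0) u / dot (binormal c t0) u).
    intros t Ht; specialize (R0 t Ht); specialize (Hk t Ht).
    apply Rmult_eq_reg_r with (curvature c t * dot (binormal c t0) u).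
    + field_simplify; [lra | exact Hl | exact Hk].
    + now apply Rmult_integral_contrapositive.
Qed.

(** * The binormal indicatrix *)

Lemma vderive_binormal (a b : Rbar) (c : R -> vec3) (t : R) :
  frenet_curve a b c -> in_itv a b t ->
  vderive (binormal c) t = scal (- (speed c t * torsion c t)) (normal c t).
Proof.
  intros Hc Ht; assert (Hv : speed c t <> 0) by (destruct Hc as [_ [_ [_ [Hv _]]]]; auto).
  apply dot_ext; intros w; rewrite (vderive_arc c) by exact Hv.
  rewrite !dot_scal_l, (arc_derive_binormal a b) by trivial; ring.
Qed.

Lemma speed_binormal (a b : Rbar) (c : R -> vec3) (t : R) :
  frenet_curve a b c -> in_itv a b t ->
  speed (binormal c) t = Rabs (speed c t * torsion c t).
Proof.
  intros Hc Ht; unfold speed at 1.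
  rewrite (vderive_binormal a b), vnorm_scal, Rabs_Ropp by trivial.
  rewrite (proj2 (vnorm_eq1 _) (normal_unit a b c t Hc Ht)); ring.
Qed.

Lemma tangent_of_binormal (a b : Rbar) (c : R -> vec3) (t : R) :
  frenet_curve a b c -> in_itv a b t -> torsion c t <> 0 ->
  exists eps, Rabs eps = 1 /\ tangent (binormal c) t = scal eps (normal c t).
Proof.
  intros Hc Ht Htau.
  assert (Hv : speed c t <> 0) by (destruct Hc as [_ [_ [_ [Hv _]]]]; auto).
  set (r := speed c t * torsion c t).
  assert (Hr : Rabs r <> 0) by now apply Rabs_no_R0, Rmult_integral_contrapositive.
  (* Minus the sign of [r]: normalizing the velocity [- r] N of the indicatrix leaves only this
     sign. *)
  exists (/ Rabs r * - r); split.
  - rewrite Rabs_mult, Rabs_inv, Rabs_Rabsolu, Rabs_Ropp; now field.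
  - apply dot_ext; intros w; unfold tangent, arc_derive.
    rewrite (speed_binormal a b), (vderive_binormal a b) by trivial; fold r.
    rewrite !dot_scal_l; ring.
Qed.

(** Regularity comes from the non-zero torsion. For the curvature, the tangent of the indicatrix is
    N up to sign, hence orthogonal to T; if its derivative vanished, differentiating this
    orthogonality would force N . T' = kappa to be 0. *)
Lemma frenet_curve_binormal (a b : Rbar) (c : R -> vec3) :
  frenet_curve a b c -> non_planar a b c -> frenet_curve a b (binormal c).
Proof.
  intros Hc Hp.
  assert (HB := smooth_binormal a b c Hc).
  assert (Hsp : forall t, in_itv a b t -> speed (binormal c) t <> 0).
  { intros t Ht; rewrite (speed_binormal a b) by trivial.
    apply Rabs_no_R0, Rmult_integral_contrapositive; split; [| now apply Hp].
    destruct Hc as [_ [_ [_ [Hv _]]]]; auto. }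
  (* [smooth_tangent] would be circular here, as it assumes that the indicatrix is a
     [frenet_curve]. *)
  assert (HT : smooth_field a b (tangent (binormal c))).
  { destruct HB as [B1 [B2 B3]]; unfold tangent, arc_derive.
    apply smooth_scal; [| now apply smooth_vderive].
    apply smooth_inv; [| exact Hsp].
    apply smooth_vnorm; [now apply smooth_vderive | exact Hsp]. }
  destruct HB as [B1 [B2 B3]]; repeat split; trivial.
  intros t Ht E.
  assert (O : forall x, in_itv a b x -> dot (tangent (binormal c) x) (tangent c x) = 0).
  { intros x Hx; destruct (tangent_of_binormal a b c x Hc Hx (Hp x Hx)) as [eps [_ ->]].
    rewrite dot_scal_l, dot_comm, (tangent_normal a b) by trivial; ring. }
  assert (D := arc_derive_dot_const a b (binormal c) _ _ 0 t HT
    (smooth_tangent a b c Hc) O Ht).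
  assert (Z : arc_derive (binormal c) (tangent (binormal c)) t = zero).
  { apply dot_self_eq0; rewrite <- vnorm_sqr; fold (curvature (binormal c) t).
    rewrite E; ring. }
  rewrite Z, dot_comm, dot_zero_r in D.
  destruct (tangent_of_binormal a b c t Hc Ht (Hp t Ht)) as [eps [Heps Et]].
  assert (Hcc := Hc); destruct Hcc as [_ [_ [_ [Hv Hk]]]].
  (* In [D] the field T is differentiated by the arclength of the indicatrix; passing to that of [c]
     brings in the ratio of the two speeds, which is non-zero. *)
  rewrite Et, dot_scal_l in D; unfold arc_derive at 1 in D.
  rewrite dot_scal_r, (vderive_arc c), dot_scal_r, dot_comm in D by auto.
  rewrite (arc_derive_tangent a b), (normal_unit a b) in D by trivial.
  assert (Heps0 : eps <> 0) by (intros ->; rewrite Rabs_R0 in Heps; lra).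
  revert D; assert (H1 := Rinv_neq_0_compat _ (Hsp t Ht)).
  specialize (Hv t Ht); specialize (Hk t Ht).
  rewrite Rplus_0_l; repeat apply Rmult_integral_contrapositive_currified; trivial; lra.
Qed.

(** The tangent lines of the indicatrix are parallel to the principal normals of [c], so the same
    axis and angle serve both sides of Lancret's criterion. *)
Lemma slant_helix_iff_binormal_helix (a b : Rbar) (c : R -> vec3) (t0 : R) :
  frenet_curve a b c -> non_planar a b c -> in_itv a b t0 ->
  slant_helix a b c <-> spherical_helix a b (binormal c).
Proof.
  intros Hc Hp Ht0.
  assert (HB := frenet_curve_binormal a b c Hc Hp).
  assert (L := const_ratio_iff_tangent_angle a b (binormal c) t0 HB Ht0).
  assert (A : forall u t, in_itv a b t ->
            line_angle (tangent (binormal c) t) u = line_angle (normal c t) u).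
  { intros u t Ht; destruct (tangent_of_binormal a b c t Hc Ht (Hp t Ht)) as [eps [He ->]].
    now apply line_angle_scal_sign. }
  split.
  - intros [_ [u [theta [Hu0 Hu]]]]; split.
    + intros t Ht; apply vnorm_eq1; now apply (binormal_unit a b).
    + split; [exact HB |]; apply L; exists u, theta; split; [exact Hu0 |].
      intros t Ht; rewrite A; auto.
  - intros [_ [_ H]]; split; [exact Hc |].
    apply L in H; destruct H as [u [theta [Hu0 Hu]]].
    exists u, theta; split; [exact Hu0 |].
    intros t Ht; rewrite <- A; auto.
Qed.

(** * Bertrand pairs and the conclusion *)

Lemma bertrand_slant_helix (a b a' b' : Rbar) (c m : R -> vec3) :
  frenet_curve a b c -> frenet_curve a' b' m -> bertrand_pair a b a' b' c m ->
  slant_helix a b c <-> slant_helix a' b' m.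
Proof.
  intros Hc Hm [phi [eps [lam [Hphi [_ [Hsurj [Heps [_ H]]]]]]]].
  assert (He : Rabs eps = 1).
  { destruct Heps as [-> | ->]; [apply Rabs_R1 |].
    rewrite Rabs_left; lra. }
  assert (A : forall u s, in_itv a b s ->
            line_angle (normal c s) u = line_angle (normal m (phi s)) u).
  { intros u s Hs; rewrite (proj1 (H s Hs)); now apply line_angle_scal_sign. }
  split; intros [_ [u [theta [Hu0 Hu]]]]; (split; [assumption |]);
    exists u, theta; (split; [exact Hu0 |]).
  (* Surjectivity of [phi] carries the constant angle to every point of the mate. *)
  - intros s' Hs'; destruct (Hsurj s' Hs') as [s [Hs <-]].
    rewrite <- A; auto.
  - intros s Hs; rewrite A; auto.
Qed.

Theorem theorem24 (a b a' b' : Rbar) (gamma gammat : R -> vec3)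
  (gamma_curve : frenet_curve a b gamma)
  (gammat_curve : frenet_curve a' b' gammat)
  (gamma_arc : arclength_param a b gamma)
  (gammat_arc : arclength_param a' b' gammat)
  (bertrand : bertrand_pair a b a' b' gamma gammat)
  (gamma_non_helical : non_helical a b gamma)
  (gammat_non_helical : non_helical a' b' gammat)
  (gamma_non_planar : non_planar a b gamma)
  (gammat_non_planar : non_planar a' b' gammat)
  (gamma_quotients : admissible_quotients a b gamma)
  (gammat_quotients : admissible_quotients a' b' gammat) :
  slant_helix a b gamma <-> spherical_helix a' b' (binormal gammat).
Proof.
  (* On an empty interval [const_ratio] would hold vacuously, against non-helicality. The point
     found here is where Lancret's theorem places its axis. *)
  assert (Hne : exists t0, in_itv a' b' t0).
  { apply NNPP; intros Hempty; apply gammat_non_helical; exists 0.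
    intros t Ht; destruct Hempty; now exists t. }
  destruct Hne as [t0 Ht0].
  rewrite (bertrand_slant_helix a b a' b' gamma gammat) by trivial.
  now apply slant_helix_iff_binormal_helix with t0.
Qed.
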